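(* Let $K=\mathbb{Z}_3$ be the field with three elements and let $G$ be a finite simple graph without isolated vertices. Then $I(X_G)$ is the vanishing ideal of the projective toric subset parameterized by $G$.
   Context: Graphs have nonempty vertex set. For a graph $G$ with vertex set $V_G$ and edge set $E_G$, let $K[V_G]=K[x_i: i\in V_G]$ and $K[E_G]=K[t_e: e\in E_G]$ be standard graded polynomial rings, and let $\theta\colon K[E_G]\to K[V_G]$ be the $K$-algebra homomorphism with $\theta(t_e)=x_ix_j$ for each edge $e=\{i,j\}$. The ideal $I(X_G)\subseteq K[E_G]$ is the (homogeneous) ideal $I(X_G)=\theta^{-1}\big((x_i^2-x_j^2 : i,j\in V_G)\big)$. Let $K$ be a finite field and let $\mathbb{P}^{|V_G|-1}$ and $\mathbb{P}^{|E_G|-1}$ be the projective spaces over $K$ (sets of $K$-points) with coordinates indexed by $V_G$ and $E_G$, respectively. Let $\mathbb{T}^{|V_G|-1}\subseteq \mathbb{P}^{|V_G|-1}$ be the set of points $(x_i)_{i\in V_G}$ all of whose homogeneous coordinates are nonzero. The projective toric subset parameterized by $G$ is the subset of $\mathbb{P}^{|E_G|-1}$ consisting of the points $(x_ix_j)_{\{i,j\}\in E_G}$ with $(x_i)_{i\in V_G}\in\mathbb{T}^{|V_G|-1}$. The vanishing ideal of a subset of $\mathbb{P}^{|E_G|-1}$ is the ideal of $K[E_G]$ generated by the homogeneous polynomials that vanish at all of its points. *)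

(* Defs.v *)
From mathcomp Require Import all_boot all_order all_algebra.
From mathcomp Require Import generic_quotient mpoly.

Set Implicit Arguments.
Unset Strict Implicit.
Unset Printing Implicit Defensive.

Import GRing.Theory.
Local Open Scope ring_scope.
Local Open Scope quotient_scope.

Section Ideals.

Variable R : comPzRingType.

Definition ideal_gen (S : R -> Prop) (f : R) : Prop :=
  exists s : seq (R * R),
    (forall cg : R * R, cg \in s -> S cg.2) /\ f = \sum_(cg <- s) cg.1 * cg.2.

End Ideals.

(* K[x_i : i in I] for an arbitrary finite index type I. The library indexes
   variables by ordinals, so i is identified with its rank in the enumeration
   of I. *)
Notation fpoly K I := {mpoly K[#|I|]}.

Section FinPoly.

Variables (K : fieldType) (I : finType).

Definition fvar (i : I) : fpoly K I := 'X_(enum_rank i).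

Definition feval (x : {ffun I -> K}) (f : fpoly K I) : K :=
  f.@[fun k => x (enum_val k)].

Definition fhomog (f : fpoly K I) : Prop :=
  exists d : nat, f \is d.-homog.

End FinPoly.

Arguments fvar K {I} i.

(* The K-points of the projective space with coordinates indexed by I: nonzero
   vectors modulo nonzero scalars. *)
Notation hcoord K I := {x : {ffun I -> K} | x != 0}.

Section ProjectiveSpace.

Variables (K : finFieldType) (I : finType).

Definition proportional (x y : hcoord K I) : bool :=
  [exists a : K, (a != 0) && (val y == [ffun i => a * val x i])].

Lemma proportional_refl : reflexive proportional.
Proof.
move=> x; apply/existsP; exists 1; rewrite oner_neq0 /=.
by apply/eqP/ffunP => i; rewrite ffunE mul1r.
Qed.

Lemma proportional_sym : ssrbool.symmetric proportional.
Proof.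
suff H x y : proportional x y -> proportional y x.
  by move=> x y; apply/idP/idP; apply: H.
case/existsP => a /andP[a0 /eqP yE]; apply/existsP; exists a^-1.
rewrite invr_eq0 a0 /=; apply/eqP/ffunP => i.
by rewrite ffunE yE ffunE mulKf.
Qed.

Lemma proportional_trans : transitive proportional.
Proof.
move=> y x z /existsP[a /andP[a0 /eqP yE]] /existsP[b /andP[b0 /eqP zE]].
apply/existsP; exists (b * a); rewrite mulf_neq0 //=.
by apply/eqP/ffunP => i; rewrite zE !ffunE yE ffunE mulrA.
Qed.

Canonical proportional_equiv :=
  EquivRel proportional proportional_refl proportional_sym proportional_trans.

Definition projective_space := {eq_quot proportional_equiv}.

Definition proj_pt (x : hcoord K I) : projective_space := \pi_projective_space x.

Definition torus (p : projective_space) : Prop :=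
  forall x : hcoord K I, p = proj_pt x -> forall i : I, val x i != 0.

Definition vanishes_at (f : fpoly K I) (p : projective_space) : Prop :=
  forall x : hcoord K I, p = proj_pt x -> feval (val x) f = 0.

Definition vanishing_ideal (X : projective_space -> Prop) : fpoly K I -> Prop :=
  ideal_gen (fun f => fhomog f /\ forall p, X p -> vanishes_at f p).

End ProjectiveSpace.

Record sgraph := SGraph {
  vert : finType;
  edges : {set {set vert}};
  edges_card2 : forall e : {set vert}, e \in edges -> #|e| = 2%N;
  vert_nonempty : (0 < #|vert|)%N
}.

Definition no_isolated_vertex (G : sgraph) : Prop :=
  forall v : vert G, exists2 e : {set vert G}, e \in edges G & v \in e.

Definition edge (G : sgraph) : finType := {e : {set vert G} | e \in edges G}.

Section GraphIdeals.

Variables (K : finFieldType) (G : sgraph).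

(* The product over the endpoints of e is x_i * x_j for e = {i, j}; see
   edge_prodE. *)
Definition edge_prod (R : comPzRingType) (x : vert G -> R) (e : edge G) : R :=
  \prod_(i in val e) x i.

Lemma edge_prodE (R : comPzRingType) (x : vert G -> R) (e : edge G)
    (i j : vert G) :
  i != j -> val e = [set i; j] -> edge_prod x e = x i * x j.
Proof.
by move=> ij eE; rewrite /edge_prod eE big_setU1 ?inE //= big_set1.
Qed.

Definition theta (f : fpoly K (edge G)) : fpoly K (vert G) :=
  f \mPo [tuple edge_prod (fvar K) (enum_val k) | k < #|edge G|].

Lemma theta_var (e : edge G) : theta (fvar K e) = edge_prod (fvar K) e.
Proof. by rewrite /theta comp_mpolyXU -tnth_nth tnth_mktuple enum_rankK. Qed.

Definition square_difference (g : fpoly K (vert G)) : Prop :=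
  exists i j : vert G, g = fvar K i ^+ 2 - fvar K j ^+ 2.

Definition IX (f : fpoly K (edge G)) : Prop :=
  ideal_gen square_difference (theta f).

Definition toric_subset (q : projective_space K (edge G)) : Prop :=
  exists (x : hcoord K (vert G)) (y : hcoord K (edge G)),
    [/\ torus (proj_pt x), val y = [ffun e => edge_prod (val x) e]
      & q = proj_pt y].

End GraphIdeals.

(* Main.v *)
(** The heart of the matter is that a homogeneous [g] in [K[V]] vanishing on
    [{1, -1}^V] lies in [J = (x_i^2 - x_j^2)] when [2 != 0] in [K]: modulo [J] a
    monomial depends only on its degree and on the parities of its exponents,
    and monomials with distinct parities restrict to distinct, hence linearly
    independent, characters of [{1, -1}^V].  Over [F_3] the affine torus is
    exactly [{1, -1}^V], so [theta] transports this to homogeneous [f] vanishing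
    on the toric subset.  Conversely, for [x] in the torus, the substitution
    [x_i |-> x_i T] kills [J] because [x_i^2 = 1], and sends [theta f] to the
    polynomial in [T] whose coefficients are the values at [(x_i x_j)] of the
    homogeneous components of [f], all of which therefore vanish. *)
Require Import Defs.
From mathcomp Require Import all_boot all_order all_algebra.
From mathcomp Require Import generic_quotient mpoly.

Set Implicit Arguments.
Unset Strict Implicit.
Unset Printing Implicit Defensive.

Import GRing.Theory.
Local Open Scope ring_scope.

(** * Generated ideals and congruences modulo them *)

Section IdealGen.

Variables (R : comPzRingType) (S : R -> Prop).

Lemma ideal_gen0 : ideal_gen S 0.
Proof. by exists [::]; rewrite big_nil. Qed.

Lemma ideal_genD f g : ideal_gen S f -> ideal_gen S g -> ideal_gen S (f + g).
Proof.
move=> [s [sS ->]] [t [tS ->]]; exists (s ++ t); rewrite big_cat; split=> // cg.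
by rewrite mem_cat => /orP[/sS|/tS].
Qed.

Lemma ideal_genMl c f : ideal_gen S f -> ideal_gen S (c * f).
Proof.
move=> [s [sS ->]]; exists [seq (c * cg.1, cg.2) | cg <- s]; split.
  by move=> _ /mapP[cg /sS ? ->].
by rewrite big_map mulr_sumr; apply: eq_bigr => cg _; rewrite mulrA.
Qed.

Lemma mem_ideal_gen f : S f -> ideal_gen S f.
Proof.
move=> Sf; exists [:: (1, f)]; rewrite big_seq1 mul1r; split=> // cg.
by rewrite inE => /eqP->.
Qed.

Lemma ideal_gen_sum (I : eqType) (r : seq I) (F : I -> R) :
  {in r, forall i, ideal_gen S (F i)} -> ideal_gen S (\sum_(i <- r) F i).
Proof.
move=> FS; rewrite big_seq; apply: big_ind => //; first exact: ideal_gen0.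
exact: ideal_genD.
Qed.

Lemma ideal_gen_congM a b c d :
  ideal_gen S (a - c) -> ideal_gen S (b - d) -> ideal_gen S (a * b - c * d).
Proof.
move=> ac bd.
rewrite (_ : a * b - c * d = a * (b - d) + d * (a - c)).
  by apply: ideal_genD; apply: ideal_genMl.
by rewrite !mulrBr (mulrC d c) (mulrC d a) addrA subrK.
Qed.

Lemma ideal_gen_cong_prod (I : Type) (r : seq I) (F H : I -> R) :
  (forall i, ideal_gen S (F i - H i)) ->
  ideal_gen S (\prod_(i <- r) F i - \prod_(i <- r) H i).
Proof.
move=> FH; apply: (big_ind2 (fun a b => ideal_gen S (a - b))) => //.
  by rewrite subrr; apply: ideal_gen0.
by move=> a b c d; apply: ideal_gen_congM.
Qed.

Lemma ideal_gen_congX a b k :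
  ideal_gen S (a - b) -> ideal_gen S (a ^+ k - b ^+ k).
Proof.
move=> ab; elim: k => [|k IHk]; first by rewrite subrr; apply: ideal_gen0.
by rewrite !exprS; apply: ideal_gen_congM.
Qed.

End IdealGen.

Lemma dhomog_bigprod (n : nat) (R : comNzRingType) (I : Type) (r : seq I)
    (F : I -> {mpoly R[n]}) (d : I -> nat) :
  (forall i, F i \is (d i).-homog) ->
  \prod_(i <- r) F i \is (\sum_(i <- r) d i).-homog.
Proof.
move=> Fd; apply: (big_rec2 (fun p e => p \is e.-homog)).
  exact: dhomog1.
by move=> i e p _; apply: dhomogM.
Qed.

(** * Homogeneous components under substitution *)

Section Homogeneous.

Variable n : nat.

Lemma dhomog_comp_mpoly (R : comNzRingType) (k e d : nat)
    (lq : n.-tuple {mpoly R[k]}) (p : {mpoly R[n]}) :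
  (forall i, tnth lq i \is e.-homog) -> p \is d.-homog ->
  p \mPo lq \is (e * d).-homog.
Proof.
move=> lqe /dhomogP pd; rewrite comp_mpolyE big_seq.
apply: rpred_sum => m /pd md; apply: dhomogZ.
rewrite -(md : mdeg m = d) mdegE big_distrr; apply: dhomog_bigprod => i.
exact: dhomogMn.
Qed.

Lemma mmap_dhomog (R : comNzRingType) (S : comNzRingType)
    (h : {rmorphism R -> S}) (v : 'I_n -> S) (a : S) d (p : {mpoly R[n]}) :
  p \is d.-homog -> mmap h (fun i => a * v i) p = a ^+ d * mmap h v p.
Proof.
move=> /dhomogP pd; rewrite /mmap mulr_sumr; apply: eq_big_seq => m /pd md.
rewrite mulrCA -(md : mdeg m = d) mdegE -prodrXr -big_split; congr (_ * _).
by apply: eq_bigr => i _; rewrite exprMn.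
Qed.

Lemma meval_dhomog (R : comNzRingType) (v : 'I_n -> R) (a : R) d
    (p : {mpoly R[n]}) :
  p \is d.-homog -> p.@[fun i => a * v i] = a ^+ d * p.@[v].
Proof. exact: (@mmap_dhomog R R idfun). Qed.

Lemma mmap_polyC (R : comNzRingType) (v : 'I_n -> R) (p : {mpoly R[n]}) :
  mmap (@polyC R) (fun i => (v i)%:P) p = (p.@[v])%:P.
Proof.
rewrite /meval /mmap rmorph_sum; apply: eq_bigr => m _.
rewrite rmorphM rmorph_prod; congr (_ * _); apply: eq_bigr => i _.
by rewrite rmorphXn.
Qed.

Lemma mmap_polyCX (R : comNzRingType) (v : 'I_n -> R) k (p : {mpoly R[n]}) :
  mmap (@polyC R) (fun i => 'X^k * (v i)%:P) p =
  \sum_(d < msize p) (pihomog mdeg d p).@[v] *: 'X^(k * d).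
Proof.
rewrite [in LHS](pihomog_partitionE (mf := mdeg) (leqnn (msize p))).
rewrite rmorph_sum; apply: eq_bigr => d _ /=.
rewrite (mmap_dhomog _ _ _ (pihomogP mdeg d p)) mmap_polyC.
by rewrite mulrC mul_polyC exprM.
Qed.

(** Since [k > 0], the exponents [k * d] are distinct, so the coefficient of ['X^(k * d)] isolates
    the value of the degree [d] component at [v]. *)
Lemma mmap_polyCX_eq0 (R : comNzRingType) (v : 'I_n -> R) k (p : {mpoly R[n]}) d :
  (0 < k)%N -> mmap (@polyC R) (fun i => 'X^k * (v i)%:P) p = 0 ->
  (pihomog mdeg d p).@[v] = 0.
Proof.
move=> k_gt0; rewrite mmap_polyCX => /(congr1 (coefp (k * d))) /=.
have [dp|pd] := ltnP d (msize p).
  rewrite coef_sum (bigD1 (Ordinal dp)) //= big1 => [|i ne_id].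
    by rewrite coefZ coefXn eqxx mulr1 addr0 coef0.
  rewrite coefZ coefXn eqn_pmul2l // (_ : (d == i) = false) ?mulr0 //.
  by rewrite eq_sym; apply: negbTE ne_id.
(* Beyond [msize p] no monomial of [p] has degree [d], so the component is an empty sum. *)
move=> _; rewrite pihomogE big_seq_cond big1 ?meval0 // => m /andP[mp /eqP md].
by have := msize_mdeg_lt mp; rewrite md ltnNge pd.
Qed.

End Homogeneous.

(** * Square differences and characters of the sign group *)

Section SquareDifferences.

Variables (K : finFieldType) (G : sgraph).

Notation J := (ideal_gen (@square_difference K G)).

Let n := #|vert G|.

Lemma square_differenceX (i j : 'I_n) : J ('X_i ^+ 2 - 'X_j ^+ 2).
Proof.
apply: mem_ideal_gen; exists (enum_val i), (enum_val j).
by rewrite /fvar !enum_valK.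
Qed.

Definition parity (m : 'X_{1..n}) : {ffun 'I_n -> bool} := [ffun i => odd (m i)].

(* Modulo [J], [X^m] depends only on [parity m] and [mdeg m]. *)
Lemma mpolyX_parity (i0 : 'I_n) (m : 'X_{1..n}) :
  J ('X_[m] - (\prod_i 'X_i ^+ parity m i) *
       ('X_i0 ^+ 2) ^+ (mdeg m - \sum_i parity m i)./2).
Proof.
have -> : (mdeg m - \sum_i parity m i)./2 = (\sum_i (m i)./2)%N.
  rewrite (_ : mdeg m = \sum_i parity m i + (\sum_i (m i)./2).*2)%N.
    by rewrite addKn doubleK.
  rewrite mdegE -muln2 big_distrl -big_split /=; apply: eq_bigr => i _.
  by rewrite ffunE muln2 odd_double_half.
rewrite -prodrXr -big_split mpolyXE_id; apply: ideal_gen_cong_prod => i.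
rewrite -{1}(odd_double_half (m i)) exprD ffunE.
apply: ideal_gen_congM; first by rewrite subrr; apply: ideal_gen0.
by rewrite -mul2n exprM; apply/ideal_gen_congX/square_differenceX.
Qed.

Hypothesis two_neq0 : 2 != 0 :> K.

Let sgn (b : {ffun 'I_n -> bool}) (i : 'I_n) : K := (-1) ^+ b i.

Lemma meval_sgn (g : {mpoly K[n]}) b :
  g.@[sgn b] = \sum_(m <- msupp g) g@_m * \prod_i (-1) ^+ (b i && parity m i).
Proof.
rewrite mevalE; apply: eq_bigr => m _; congr (_ * _); apply: eq_bigr => i _.
by rewrite -exprM ffunE -[LHS]signr_odd oddM oddb.
Qed.

(** The sum over sign vectors factors into one sum over two signs per coordinate: it is 2 where [p]
    and [q] agree, and 1 - 1 = 0 where they differ. *)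
Lemma sgn_orthogonal (p q : {ffun 'I_n -> bool}) :
  \sum_(b : {ffun 'I_n -> bool})
     (\prod_i (-1) ^+ (b i && p i) * \prod_i (-1) ^+ (b i && q i))
  = if p == q then 2 ^+ n else 0 :> K.
Proof.
under eq_bigr do rewrite -big_split /=.
rewrite -(bigA_distr_bigA (fun i (c : bool) =>
  (-1) ^+ (c && p i) * (-1) ^+ (c && q i))) /=.
under eq_bigr => i _ do rewrite big_bool /= mulr1 -signr_addb.
case: eqP => [->|/eqP ne_pq].
  under eq_bigr do rewrite addbb.
  by rewrite prodr_const card_ord.
have [i ne_i] : exists i, p i != q i.
  apply/existsP; apply: contraNT ne_pq => /existsPn pq.
  by apply/eqP/ffunP => i; apply/eqP; rewrite -[_ == _]negbK pq.
rewrite (bigD1 i) //= (_ : p i (+) q i) ?addNr ?mul0r //.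
by rewrite -negb_eqb.
Qed.

(** Fourier inversion: pairing the values of [g] with the character of [q] gives [2 ^+ n] times this
    sum, and [2 ^+ n] can be cancelled. *)
Lemma parity_coef_eq0 (g : {mpoly K[n]}) (q : {ffun 'I_n -> bool}) :
  (forall b, g.@[sgn b] = 0) ->
  \sum_(m <- msupp g | parity m == q) g@_m = 0.
Proof.
move=> g0; apply: (mulfI (expf_neq0 n two_neq0)); rewrite mulr0.
transitivity (\sum_(b : {ffun 'I_n -> bool})
    g.@[sgn b] * \prod_i (-1) ^+ (b i && q i)); last first.
  by apply: big1 => b _; rewrite g0 mul0r.
under [RHS]eq_bigr do rewrite meval_sgn mulr_suml.
rewrite exchange_big /= mulr_sumr big_mkcond; apply: eq_bigr => m _.
under [RHS]eq_bigr do rewrite -mulrA.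
by rewrite -mulr_sumr sgn_orthogonal mulrC; case: eqP; rewrite ?mulr0.
Qed.

Lemma dhomog_vanishing_sgn (d : nat) (g : {mpoly K[n]}) :
  g \is d.-homog -> (forall b, g.@[sgn b] = 0) -> J g.
Proof.
move=> /dhomogP gd g0; have i0 : 'I_n := Ordinal (vert_nonempty G).
(* [N q] is the common normal form modulo [J] of the degree [d] monomials of parity [q]. *)
pose N q := (\prod_i 'X_i ^+ (q : {ffun 'I_n -> bool}) i) *
  ('X_i0 ^+ 2) ^+ (d - \sum_i q i)./2 : {mpoly K[n]}.
(* Grouped by parity, the normal forms cancel, so [g] is the sum of the differences between its
   terms and their normal forms. *)
have N0 : \sum_(m <- msupp g) g@_m *: N (parity m) = 0.
  rewrite (partition_big parity predT) //=; apply: big1 => q _.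
  rewrite (eq_bigr (fun m => g@_m *: N q)) => [|m /eqP -> //].
  by rewrite -scaler_suml parity_coef_eq0 ?scale0r.
rewrite -[g]subr0 -N0 {1}[g]mpolyE -sumrB; apply: ideal_gen_sum => m mg.
rewrite -scalerBr -mul_mpolyC; apply: ideal_genMl.
by rewrite /N -(gd m mg); apply: mpolyX_parity.
Qed.

End SquareDifferences.

Lemma mmap_comp_mpoly (n k : nat) (R S : comNzRingType)
    (h : {rmorphism R -> S}) (v : 'I_k -> S) (lq : n.-tuple {mpoly R[k]})
    (p : {mpoly R[n]}) :
  mmap h v (p \mPo lq) = mmap h (fun i => mmap h v (tnth lq i)) p.
Proof.
rewrite comp_mpolyE rmorph_sum; apply: eq_bigr => m _ /=.
rewrite mmapZ rmorph_prod; congr (_ * _); apply: eq_bigr => i _.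
by rewrite rmorphXn.
Qed.

(** * The map [theta] and the curve [x_i = x i * T] *)

Section Theta.

Variables (K : finFieldType) (G : sgraph).

Lemma dhomog_edge_prod (e : edge G) : edge_prod (fvar K) e \is 2.-homog.
Proof.
rewrite -(edges_card2 (valP e)) -sum1_card /edge_prod -!big_enum /=.
by apply: dhomog_bigprod => i; rewrite dhomogX /= mdeg1.
Qed.

Lemma dhomog_theta d (f : fpoly K (edge G)) :
  f \is d.-homog -> theta f \is (2 * d).-homog.
Proof.
by apply: dhomog_comp_mpoly => k; rewrite tnth_mktuple dhomog_edge_prod.
Qed.

Lemma meval_theta (v : 'I_#|vert G| -> K) (f : fpoly K (edge G)) :
  (theta f).@[v] =
  feval [ffun e => edge_prod (fun i => v (enum_rank i)) e] f.
Proof.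
rewrite /theta comp_mpoly_meval; apply: meval_eq => k.
rewrite tnth_mktuple ffunE /edge_prod rmorph_prod; apply: eq_bigr => i _.
exact: mevalXU.
Qed.

Lemma mmap_theta (x : vert G -> K) (f : fpoly K (edge G)) :
  mmap (@polyC K) (fun k => 'X * (x (enum_val k))%:P) (theta f) =
  mmap (@polyC K) (fun k => 'X^2 * (edge_prod x (enum_val k))%:P) f.
Proof.
rewrite mmap_comp_mpoly; apply: eq_bigr => m _; congr (_ * _).
apply: eq_bigr => k _; congr (_ ^+ _); rewrite tnth_mktuple.
set e := enum_val k; rewrite {1}/edge_prod rmorph_prod /=.
(* Reading the exponent 2 as the cardinal of [e] gives one factor ['X] to each endpoint. *)
rewrite -(edges_card2 (valP e)) -prodr_const /edge_prod rmorph_prod -big_split.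
by apply: eq_bigr => i _; rewrite /fvar mmapX mmap1U enum_rankK.
Qed.

Lemma mmap_square_difference_eq0 (x : vert G -> K) (g : fpoly K (vert G)) :
  (forall i, x i ^+ 2 = 1) -> ideal_gen (@square_difference K G) g ->
  mmap (@polyC K) (fun k => 'X * (x (enum_val k))%:P) g = 0.
Proof.
move=> x2 [s [sS ->]]; rewrite rmorph_sum big_seq big1 // => cg /sS[i [j ->]].
rewrite /= rmorphM rmorphB !rmorphXn /= /fvar !mmapX !mmap1U !enum_rankK.
by rewrite !exprMn -!rmorphXn !x2 subrr mulr0.
Qed.

Lemma feval_pihomog_IX (x : vert G -> K) d (f : fpoly K (edge G)) :
  (forall i, x i ^+ 2 = 1) -> IX f ->
  feval [ffun e => edge_prod x e] (pihomog mdeg d f) = 0.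
Proof.
move=> x2 /(mmap_square_difference_eq0 x2); rewrite mmap_theta.
move=> /(mmap_polyCX_eq0 d (isT : 0 < 2)%N) <-.
by apply: meval_eq => k; rewrite ffunE.
Qed.

Lemma IX_ideal_gen (S : fpoly K (edge G) -> Prop) f :
  (forall g, S g -> IX g) -> ideal_gen S f -> @IX K G f.
Proof.
move=> SI [s [sS ->]]; rewrite /IX /theta rmorph_sum.
apply: ideal_gen_sum => cg /sS/SI; rewrite rmorphM; exact: ideal_genMl.
Qed.

(** A vertex exists and lies on some edge; the coordinate of that edge is a product of nonzero
    factors. This makes the parameterized point a legitimate projective point. *)
Lemma edge_prod_neq0 (x : vert G -> K) :
  no_isolated_vertex G -> (forall i, x i != 0) ->
  [ffun e => edge_prod x e] != 0.
Proof.
move=> hG x0; have /card_gt0P[v _] := vert_nonempty G.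
have [e eG _] := hG v; apply/eqP => /ffunP/(_ (exist _ e eG)).
by rewrite !ffunE; apply/eqP/prodf_neq0.
Qed.

End Theta.

(** * Independence of the choice of homogeneous coordinates *)

Section ProjectivePoints.

Variables (K : finFieldType) (I : finType).

Definition Hcoord (x : {ffun I -> K}) (x0 : x != 0) : hcoord K I :=
  exist _ x x0.

Lemma proj_ptP (x y : hcoord K I) :
  reflect (exists2 a : K, a != 0 & val y = [ffun i => a * val x i])
          (proj_pt x == proj_pt y).
Proof.
rewrite /proj_pt eqmodE; apply: (iffP existsP).
  by move=> [a /andP[a0 /eqP yE]]; exists a.
by move=> [a a0 yE]; exists a; rewrite a0 yE eqxx.
Qed.

Lemma torus_proj_pt (x : hcoord K I) :
  torus (proj_pt x) <-> forall i, val x i != 0.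
Proof.
split=> [/(_ x erefl) //|x0 y /eqP/proj_ptP[a a0 ->] i].
by rewrite ffunE mulf_neq0.
Qed.

Lemma vanishes_at_proj_pt d (f : fpoly K I) (x : hcoord K I) :
  f \is d.-homog -> vanishes_at f (proj_pt x) <-> feval (val x) f = 0.
Proof.
move=> fd; split=> [/(_ x erefl) //|fx y /eqP/proj_ptP[a _ ->]].
rewrite -[RHS](mulr0 (a ^+ d)) -fx; apply: etrans (meval_dhomog _ _ fd).
by apply: meval_eq => k; rewrite ffunE.
Qed.

End ProjectivePoints.

Lemma sqr_F3 (a : 'F_3) : a != 0 -> a ^+ 2 = 1.
Proof. by case: a => [[|[|[|//]]]] ? // _; apply: val_inj. Qed.

Theorem proposition2p9 (G : sgraph) (hG : no_isolated_vertex G)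
    (f : fpoly 'F_3 (edge G)) :
  @IX 'F_3 G f <-> vanishing_ideal (@toric_subset 'F_3 G) f.
Proof.
split=> [fI|].
  (* Each homogeneous component of [f] is shown to be one of the generators of the vanishing
     ideal. *)
  rewrite [f](pihomog_partitionE (mf := mdeg) (leqnn _)).
  apply: ideal_gen_sum => d _; apply: mem_ideal_gen.
  split; first by exists d; apply: pihomogP.
  move=> _ [x [y [/torus_proj_pt x0 yE ->]]].
  apply/(vanishes_at_proj_pt _ (pihomogP mdeg d f)); rewrite yE.
  by apply: feval_pihomog_IX => // i; apply/sqr_F3/x0.
(* It suffices to treat a homogeneous generator [g]; every sign vector is then realized as a torus
   point, at whose image [g] vanishes. *)
apply: IX_ideal_gen => g [[d gd] gX].
apply: (dhomog_vanishing_sgn _ (dhomog_theta gd)) => // b; rewrite meval_theta.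
pose x i : 'F_3 := (-1) ^+ b (enum_rank i).
have x0 i : x i != 0 by rewrite signr_eq0.
have xv0 : [ffun i => x i] != 0.
  have /card_gt0P[v _] := vert_nonempty G.
  by apply/eqP => /ffunP/(_ v); rewrite !ffunE; apply/eqP.
pose y := Hcoord (edge_prod_neq0 hG x0).
apply/(vanishes_at_proj_pt y gd)/gX; exists (Hcoord xv0), y; split=> //.
  by apply/torus_proj_pt => i; rewrite ffunE.
by apply/ffunP => e; rewrite !ffunE; apply: eq_bigr => i _; rewrite ffunE.
Qed.
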